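(* Let $T$ be a contraction on a Hilbert space $\mathcal{H}$, and let $Q, X\in\mathcal{B}(\mathcal{H})$ be arbitrary. Suppose $V$ on a Hilbert space $\mathcal{K}\supseteq\mathcal{H}$ is an isometric lift of $T$ and $\overline{Q}\in\mathcal{B}(\mathcal{K})$ is any lift of $Q$. \begin{enumerate} \item If $XT=QTX$ and if $QT$ and $\overline{Q}V$ are contractions, then there is a norm preserving lift $Y\in\mathcal{B}(\mathcal{K})$ of $X$ such that $YV=\overline{Q}VY$. \item If $XT=TQX$ and if $TQ$ and $V\overline{Q}$ are contractions, then there is a norm preserving lift $Y\in\mathcal{B}(\mathcal{K})$ of $X$ such that $YV=V\overline{Q}Y$. \item If $TX=XTQ$ and if $Q$ is a contraction and $\overline{Q}$ is an isometry, then there is a norm preserving lift $Y\in\mathcal{B}(\mathcal{K})$ of $X$ such that $VY=YV\overline{Q}$. \end{enumerate}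
   Context: All Hilbert spaces are complex; $\mathcal{B}(\mathcal{H})$ is the algebra of bounded linear operators on $\mathcal{H}$; $\mathcal{H}\subseteq\mathcal{K}$ means $\mathcal{H}$ is a closed linear subspace of $\mathcal{K}$; a contraction is an operator of norm at most one. An operator $B\in\mathcal{B}(\mathcal{K})$ is a lift (lifting) of $A\in\mathcal{B}(\mathcal{H})$, $\mathcal{H}\subseteq\mathcal{K}$, if $\mathcal{H}$ is invariant under $B^*$ and $B^*|_{\mathcal{H}}=A^*$. It is an isometric lift if in addition $B$ is an isometry, and a norm preserving lift if in addition $\|B\|=\|A\|$. *)

(* Defs.v *)
From HB Require Import structures.
From mathcomp Require Import all_boot all_order all_algebra.
From mathcomp Require Import complex.
From mathcomp Require Import all_classical all_reals all_analysis.
From mathcomp Require Import ring lra.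

Set Implicit Arguments.
Unset Strict Implicit.
Unset Printing Implicit Defensive.

Import Order.TTheory GRing.Theory Num.Theory.
Import numFieldNormedType.Exports.

Local Open Scope classical_set_scope.
Local Open Scope ring_scope.
Local Open Scope complex_scope.

HB.mixin Record CompleteNormedModule_isHilbert (R : realType) (H : Type)
    of CompleteNormedModule R[i] H := {
  dotH : {dot H for Num.conj};
  dotHH : forall x : H, dotH x x = `|x| ^+ 2
}.

#[short(type="hilbertType")]
HB.structure Definition Hilbert (R : realType) :=
  {H of CompleteNormedModule R[i] H & CompleteNormedModule_isHilbert R H}.

(* The norm of a normed module over [R[i]] takes its values in [R[i]]; [hnorm]
   is the same number in [R]. *)
Definition hnorm (R : realType) (H : hilbertType R) (x : H) : R :=
  complex.Re `|x|.

HB.mixin Record isBoundedOp (R : realType) (H K : hilbertType R) (A : H -> K)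
  := { boundedP : exists M : R, forall x, hnorm (A x) <= M * hnorm x }.

#[short(type="boundedOp")]
HB.structure Definition BoundedOp (R : realType) (H K : hilbertType R) :=
  {A of @GRing.Linear R[i] H K *:%R A & isBoundedOp R H K A}.

Notation "{ 'bounded' H -> K }" := (boundedOp H%type K%type)
  (at level 0, H at level 98, format "{ 'bounded'  H  ->  K }") : type_scope.

Section Riesz.
Variables (R : realType) (H : hilbertType R).
Implicit Types x y z : H.

Let Cr x : `|x| = (hnorm x)%:C.
Proof. by rewrite /hnorm RRe_real// realE normr_ge0. Qed.

Lemma hnorm_ge0 x : 0 <= hnorm x.
Proof. by rewrite -ler0c -Cr. Qed.

Let rD x y : hnorm (x + y) <= hnorm x + hnorm y.
Proof. by rewrite -lecR raddfD/= -!Cr; apply: ler_normD. Qed.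

Let rN x : hnorm (- x) = hnorm x.
Proof. by rewrite /hnorm normrN. Qed.

Let D x y : R := complex.Re (dotH x y).

Let DC x y : D x y = D y x.
Proof.
have : dotH x y = Num.conj (dotH y x).
  by have := hermC (@dotH _ H) x y; rewrite expr0 mul1r.
by rewrite /D => ->; case: (dotH y x).
Qed.

Let DDl x y z : D (x + y) z = D x z + D y z.
Proof. by rewrite /D linearDl raddfD. Qed.

Let DDr x y z : D z (x + y) = D z x + D z y.
Proof. by rewrite DC DDl DC (DC y). Qed.

Let DZl t x y : D (t%:C *: x) y = t * D x y.
Proof. by rewrite /D linearZl_LR/=; case: (dotH x y) => a b; simpc. Qed.

Let DZr t x y : D x (t%:C *: y) = t * D x y.
Proof. by rewrite DC DZl DC. Qed.

Lemma Re_dotHH x : complex.Re (dotH x x) = hnorm x ^+ 2.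
Proof. by rewrite dotHH Cr -rmorphXn. Qed.

Let Dxx : forall x, D x x = hnorm x ^+ 2 := Re_dotHH.

Let D_lb x y : - (hnorm x * hnorm y) <= D x y.
Proof.
have := rD (x + y) (- x); rewrite addrAC subrr add0r rN => h1.
have := rD (x + y) (- y); rewrite -addrA subrr addr0 rN => h2.
have := hnorm_ge0 (x + y); have := hnorm_ge0 x; have := hnorm_ge0 y.
have := Dxx (x + y); rewrite DDl !DDr (DC y x) !Dxx.
by move: h1 h2; have [|] := lerP (hnorm x) (hnorm y); nra.
Qed.

Lemma Re_dotH_le x y : complex.Re (dotH x y) <= hnorm x * hnorm y.
Proof.
have := D_lb ((-1)%:C *: x) y; rewrite DZl mulN1r lerN2.
by rewrite raddfN/= scaleN1r rN.
Qed.

Lemma riesz (phi : {linear H -> R[i] | *%R}) :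
  (exists M : R, forall x, complex.Re (phi x) <= M * hnorm x) ->
  exists z, forall x, phi x = dotH x z.
Proof.
move=> [M pM0].
pose p x := complex.Re (phi x).
have pD x y : p (x + y) = p x + p y by rewrite /p linearD raddfD.
have pM x : `|p x| <= M * hnorm x.
  rewrite ler_norml pM0 andbT lerNl -(rN x) -raddfN/=.
  by have := pM0 (- x); rewrite linearN.
have pZ t x : p (t%:C *: x) = t * p x.
  by rewrite /p linearZ/=; case: (phi x) => a b; simpc.
pose F x := hnorm x ^+ 2 - 2 * p x.
have FD x y : F (x + y) = F x + hnorm y ^+ 2 + 2 * (D x y - p y).
  by rewrite /F -!Dxx DDl !DDr (DC y) pD; ring.
have F_lb x : - M ^+ 2 <= F x.
  have := pM x; rewrite ler_norml /F => /andP[_].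
  by have := sqr_ge0 (hnorm x - M); nra.
have par x y : hnorm (x - y) ^+ 2 =
    2 * F x + 2 * F y - 4 * F ((2^-1)%:C *: (x + y)).
  rewrite /F -!Dxx DZl DZr -scaleN1r.
  have -> : -1 = (-1)%:C :> R[i] by rewrite raddfN.
  by rewrite !DDl !DDr !DZl !DZr pZ pD (DC y); field.
pose E := range F.
have infE : has_inf E.
  split; first by exists (F 0), 0.
  by exists (- M ^+ 2) => _ [x _ <-].
pose d := inf E.
have dF x : d <= F x by apply: ge_inf; [case: infE | exists x].
have dlt e : 0 < e -> exists x, F x < d + e.
  by move=> /inf_adherent -/(_ _ infE)[_ [x _ <-]]; exists x.
pose G : set_system H :=
  filter_from [set e : R | 0 < e] (fun e => [set x | F x < d + e]).
have GF : ProperFilter G.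
  apply: filter_from_proper; last by move=> e /= /dlt.
  apply: filter_from_filter; first by exists 1 => /=.
  move=> e f /= e0 f0; exists (Num.min e f); first by rewrite /= lt_min e0.
  by move=> x /= xd; split; apply: lt_le_trans xd _; rewrite lerD2l ge_min lexx ?orbT.
have Gc : cauchy G.
  apply/cauchy_ballP => e e0.
  have [eC r0] : e = (complex.Re e)%:C /\ 0 < complex.Re e.
    have eC : e = (complex.Re e)%:C by rewrite RRe_real// gtr0_real.
    by split; rewrite // -ltcR -eC.
  set r := complex.Re e in eC r0.
  pose A := [set x | F x < d + r ^+ 2 / 4].
  have GA : G A by exists (r ^+ 2 / 4) => //=; rewrite divr_gt0// exprn_gt0.
  exists (A, A) => //= -[x y] /= [Ax Ay].
  rewrite -ball_normE/= eC Cr ltcR -(ltr_pXn2r (ltn0Sn 1)) ?nnegrE ?hnorm_ge0// ?ltW//.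
  by rewrite par; have := dF ((2^-1)%:C *: (x + y)); rewrite /A/= in Ax Ay *; lra.
have /cvg_ex[z Gz] : cvg G by exact: cauchy_cvg.
have Fz : F z = d.
  apply/eqP; rewrite eq_le dF andbT; apply/ler_addgt0Pl => e e0.
  pose c := hnorm z + `|M| + 1.
  have c1 : 1 <= c by rewrite /c lerDr addr_ge0// hnorm_ge0.
  pose s := e / (4 * c).
  have s0 : 0 < s by rewrite divr_gt0// mulr_gt0//; lra.
  have es : e = 4 * c * s by rewrite /s; field; lra.
  have : G (ball z s%:C `&` [set x | F x < d + e / 2]).
    apply: filterI; first by apply: Gz; apply: nbhsx_ballx; rewrite ltcR.
    by exists (e / 2) => //=; lra.
  move=> /filter_ex[x [zx Fx]]; rewrite /= in Fx.
  have {}zx : hnorm (x - z) < s.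
    by move: zx; rewrite -ball_normE/= Cr ltcR -opprB rN.
  have := FD z (x - z); rewrite addrC subrK => Fxz.
  have := D_lb z (x - z); have := pM (x - z); rewrite ler_norml => /andP[_ pu] Du.
  have n0 := hnorm_ge0 (x - z); have z0 := hnorm_ge0 z.
  have MM : M * hnorm (x - z) <= `|M| * hnorm (x - z) by rewrite ler_wpM2r// ler_norm.
  have cs : (hnorm z + `|M|) * hnorm (x - z) <= c * s.
    by apply: ler_pM; rewrite ?addr_ge0 ?(ltW zx)// /c; lra.
  have := sqr_ge0 (hnorm (x - z)).
  rewrite mulrDl in cs.
  lra.
have L0 y : D z y = p y.
  have Lt t : 0 <= t ^+ 2 * hnorm y ^+ 2 + 2 * t * (D z y - p y).
    have := dF (z + t%:C *: y); rewrite FD Fz -Dxx DZl !DZr Dxx pZ; lra.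
  set a := hnorm y ^+ 2 in Lt; set b := D z y - p y in Lt.
  suff : b = 0 by rewrite /b; lra.
  have a0 : 0 <= a by apply: sqr_ge0.
  have := Lt (- b / (a + 1)).
  have -> : (- b / (a + 1)) ^+ 2 * a + 2 * (- b / (a + 1)) * b =
    - (b ^+ 2 * ((a + 2) / (a + 1) ^+ 2)) by field; lra.
  rewrite oppr_ge0 pmulr_lle0 ?divr_gt0 ?exprn_gt0//; try lra.
  by move=> b0; apply/eqP; rewrite -sqrf_eq0 eq_le b0 sqr_ge0.
exists z => x.
have ReL u : complex.Re (phi u) = complex.Re (dotH u z) by rewrite -/(D u z) DC L0.
have e1 : phi ('i%C *: x) = 'i%C * phi x by rewrite linearZ.
have e2 : dotH ('i%C *: x) z = 'i%C * dotH x z by rewrite linearZl_LR.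
have := ReL ('i%C *: x); have := ReL x; rewrite e1 e2.
by case: (phi x) (dotH x z) => a b [a' b'] /=; simpc => -> /oppr_inj ->.
Qed.
End Riesz.

Section Composition.
Variables (R : realType) (H K L : hilbertType R).
Variables (B : {bounded K -> L}) (A : {bounded H -> K}).

Lemma comp_bounded :
  exists M : R, forall x, hnorm ((B \o A) x) <= M * hnorm x.
Proof.
have [M HM] := @boundedP _ _ _ A; have [N HN] := @boundedP _ _ _ B.
exists (`|N| * M) => x /=; rewrite (le_trans (HN _))// -mulrA.
apply: (@le_trans _ _ (`|N| * hnorm (A x))).
  by rewrite ler_wpM2r ?hnorm_ge0// ler_norm.
by rewrite ler_wpM2l.
Qed.

HB.instance Definition _ := isBoundedOp.Build R H L (B \o A) comp_bounded.
End Composition.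

Section Adjoint.
Variables (R : realType) (H K : hilbertType R) (A : {bounded H -> K}).

Definition adjoint (y : K) : H :=
  xget 0 [set z | forall x, dotH (A x) y = dotH x z].

Lemma adjointP x y : dotH (A x) y = dotH x (adjoint y).
Proof.
suff [z Hz] : exists z, forall x, dotH (A x) y = dotH x z.
  by have := @xgetI _ 0 [set z | forall x, dotH (A x) y = dotH x z] z Hz; apply.
pose phi x := dotH (A x) y.
have phiL : linear_for *%R phi.
  by move=> a u v; rewrite /phi linearP linearDl linearZl_LR.
pose phi' : {linear H -> R[i] | *%R} :=
  HB.pack phi (GRing.isLinear.Build _ _ _ _ phi phiL).
apply: (riesz (phi := phi')).
have [M HM] := @boundedP _ _ _ A; exists (M * hnorm y) => u.
apply: le_trans (Re_dotH_le _ _) _.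
by rewrite mulrAC ler_wpM2r ?hnorm_ge0.
Qed.

Lemma dotH_inj (u v : H) : (forall x, dotH x u = dotH x v) -> u = v.
Proof.
move=> e; apply/eqP; rewrite -subr_eq0 -normr_eq0 -sqrf_eq0 -dotHH.
by rewrite linearBr/= e subrr.
Qed.

Lemma adjoint_linear : linear adjoint.
Proof.
move=> a u v; apply: dotH_inj => x.
by rewrite -adjointP !linearDr/= !linearZr_LR/= !adjointP.
Qed.

HB.instance Definition _ :=
  GRing.isLinear.Build R[i] K H *:%R adjoint adjoint_linear.

Lemma adjoint_bounded :
  exists M : R, forall y, hnorm (adjoint y) <= M * hnorm y.
Proof.
have [M HM] := @boundedP _ _ _ A; exists `|M| => y.
have := Re_dotH_le (A (adjoint y)) y; rewrite adjointP Re_dotHH => le1.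
have := hnorm_ge0 (adjoint y); rewrite le_eqVlt => /orP[/eqP a0|a0].
  by rewrite -a0 mulr_ge0// hnorm_ge0.
rewrite -(ler_pM2l a0) -expr2 (le_trans le1)// mulrA.
rewrite ler_wpM2r ?hnorm_ge0// (le_trans (HM _))//.
by rewrite mulrC ler_wpM2l ?hnorm_ge0// ler_norm.
Qed.

HB.instance Definition _ := isBoundedOp.Build R K H adjoint adjoint_bounded.
End Adjoint.

Section OperatorNotions.
Variable R : realType.
Implicit Types H K : hilbertType R.

Definition opnorm H K (A : {bounded H -> K}) : R :=
  sup [set hnorm (A x) | x in [set x | hnorm x <= 1]].

Definition contractive H K (A : {bounded H -> K}) := opnorm A <= 1.

Definition isometric H K (A : {bounded H -> K}) :=
  forall x, hnorm (A x) = hnorm x.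

(* An inclusion of [H] in [K] as a closed subspace is given by a linear isometry
   [J : H -> K], [H] being identified with the range of [J] (which is closed, as
   [H] is complete).  The equation says both that the adjoint of [B] leaves that
   range invariant and that it restricts there to the adjoint of [A]. *)
Definition is_lift H K (J : {bounded H -> K})
    (A : {bounded H -> H}) (B : {bounded K -> K}) :=
  forall x, adjoint B (J x) = J (adjoint A x).

Definition is_isometric_lift H K (J : {bounded H -> K})
    (A : {bounded H -> H}) (B : {bounded K -> K}) :=
  is_lift J A B /\ isometric B.

Definition is_norm_preserving_lift H K (J : {bounded H -> K})
    (A : {bounded H -> H}) (B : {bounded K -> K}) :=
  is_lift J A B /\ opnorm B = opnorm A.

End OperatorNotions.

(* Main.v *)
Require Import Defs.
From HB Require Import structures.
From mathcomp Require Import all_boot all_order all_algebra.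
From mathcomp Require Import complex.
From mathcomp Require Import all_classical all_reals all_analysis.
From mathcomp Require Import ring lra.

Import Order.TTheory GRing.Theory Num.Theory.
Import numFieldNormedType.Exports.

(** The three claims are instances of one commutant lifting theorem: if [V] is
an isometric lift of [T1], [W] a contractive lift of [T2] and [X T1 = T2 X],
then [X] has a norm preserving lift [Y] with [Y V = W Y].  Claim 1 takes
[W = Qbar V] over [T2 = Q T], claim 2 takes [W = V Qbar] over [T2 = T Q], and
claim 3 takes [W = V] over [T2 = T] and, on the source side, the isometric lift
[V Qbar] of [T1 = T Q].

The theorem is proved on adjoints, without dilating [W].  Put [C = W*] and
[g = opnorm X].  The operator [Z0 = J1 X*] on the subspace [J2 H2], which is
invariant under [C], satisfies [V* Z0 = Z0 C] there, and it has to be extended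
to an operator [Z] with [V* Z = Z C] and norm at most [g]; then [Y = Z*].

Start from any extension [Z] of norm at most [g], for instance [Z0] composed
with the orthogonal projection.  It can be improved to an extension [Z'], still
of norm at most [g], with [V* Z' = Z C] ([intertwining_step]).  As [V] is an
isometry, such a [Z'] has the form [V Z C + D] with [D] valued in the kernel of
[V*], and its norm is at most [g] exactly when
  [|D x|^2 <= g^2 |x|^2 - |Z C x|^2].
On [J2 H2] the operator [D] is prescribed and satisfies this bound; the right
hand side is a nonnegative quadratic form, so a Hilbert space analogue of the
Hahn-Banach theorem ([dominated_extension]) extends [D] with the same bound.

Iterating gives extensions [Z_n] with [V* Z_(n+1) = Z_n C].  Their weak limit
along a Banach limit ([banach_limit], [weak_banach_limit]) no longer sees the
shift of the index, hence is an extension with [V* Z = Z C]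
([intertwining_extension]). *)

(** * The real part of the inner product *)

Section RealInnerProduct.
Set Implicit Arguments.
Unset Strict Implicit.
Local Open Scope classical_set_scope.
Local Open Scope ring_scope.
Local Open Scope complex_scope.

Definition rdot (R : realType) (H : hilbertType R) (x y : H) : R :=
  complex.Re (dotH x y).

Variables (R : realType) (H : hilbertType R).
Implicit Types (x y z : H) (a : R[i]) (t : R).

Lemma rdotC x y : rdot x y = rdot y x.
Proof.
have : dotH x y = Num.conj (dotH y x).
  by have := hermC (@dotH _ H) x y; rewrite expr0 mul1r.
by rewrite /rdot => ->; case: (dotH y x).
Qed.

Lemma rdotDl x y z : rdot (x + y) z = rdot x z + rdot y z.
Proof. by rewrite /rdot linearDl raddfD. Qed.

Lemma rdotNl x z : rdot (- x) z = - rdot x z.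
Proof. by rewrite /rdot linearNl raddfN. Qed.

Lemma rdotDr x y z : rdot z (x + y) = rdot z x + rdot z y.
Proof. by rewrite rdotC rdotDl !(rdotC z). Qed.

Lemma rdotNr x z : rdot z (- x) = - rdot z x.
Proof. by rewrite rdotC rdotNl rdotC. Qed.

Lemma rdotZl t x y : rdot (t%:C *: x) y = t * rdot x y.
Proof. by rewrite /rdot linearZl_LR/=; case: (dotH x y) => a b; simpc. Qed.

(** Only the real part of the inner product is used below; this rule is how it
    still controls complex scalars. *)
Lemma rdotZr_conj a x y : rdot x (a *: y) = rdot (Num.conj a *: x) y.
Proof. by rewrite /rdot linearZl_LR linearZr_LR. Qed.

Lemma rdotZZ a x y : rdot (a *: x) (a *: y) = complex.Re `|a| ^+ 2 * rdot x y.
Proof.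
rewrite rdotZr_conj scalerA (mulrC _ a) -rdotZl; congr (rdot (_ *: _) _).
by rewrite -normCK -{1}[`|a|]RRe_real ?normr_real// -rmorphXn.
Qed.

Lemma rdotxx x : rdot x x = hnorm x ^+ 2.
Proof. exact: Re_dotHH. Qed.

Lemma rdot_le x y : rdot x y <= hnorm x * hnorm y.
Proof. exact: Re_dotH_le. Qed.

Lemma hnorm0 : hnorm (0 : H) = 0.
Proof. by rewrite /hnorm normr0. Qed.

Lemma hnorm_opp x : hnorm (- x) = hnorm x.
Proof. by rewrite /hnorm normrN. Qed.

Lemma hnormC x : `|x| = (hnorm x)%:C.
Proof. by rewrite /hnorm RRe_real// normr_real. Qed.

Lemma hnorm_add x y : hnorm (x + y) <= hnorm x + hnorm y.
Proof. by rewrite -lecR raddfD/= -!hnormC; apply: ler_normD. Qed.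

Lemma hnorm_scale a x : hnorm (a *: x) = complex.Re `|a| * hnorm x.
Proof.
rewrite /hnorm normrZ -[`|a|]RRe_real ?normr_real//.
by rewrite -[`|x|]RRe_real ?normr_real//; simpc.
Qed.

Lemma hnorm0_eq0 x : hnorm x = 0 -> x = 0.
Proof. by move=> x0; apply/eqP; rewrite -normr_eq0 hnormC x0. Qed.

Lemma rdot_inj y z : (forall x, rdot x y = rdot x z) -> y = z.
Proof.
move=> e; apply/eqP; rewrite -subr_eq0; apply/eqP/hnorm0_eq0/eqP.
by rewrite -sqrf_eq0 -rdotxx rdotDr rdotNr e subrr.
Qed.

(** A real-linear functional [p] is the real part of the complex-linear one
    [p x - i p (i x)], so the complex representation theorem applies. *)
Lemma real_riesz (p : H -> R) (M : R) :
  (forall x y, p (x + y) = p x + p y) ->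
  (forall t x, p (t%:C *: x) = t * p x) ->
  (forall x, p x <= M * hnorm x) ->
  exists z, forall x, p x = rdot x z.
Proof.
move=> pD pZ pM.
pose phi x : R[i] := (p x) -i* p ('i *: x).
have phiL : linear_for *%R phi.
  case=> a b u v; rewrite /phi.
  have -> : a +i* b = a%:C + 'i * b%:C by simpc.
  have ii : 'i * 'i = (-1)%:C :> R[i] by simpc.
  rewrite !scalerDr !scalerDl !scalerDr !scalerA mulrA ii -rmorphM.
  rewrite (mulrC 'i a%:C) (mulrC 'i b%:C) -!scalerA !pD !pZ.
  by simpc; congr (_ +i* _); ring.
pose phi' : {linear H -> R[i] | *%R} :=
  HB.pack phi (GRing.isLinear.Build _ _ _ _ phi phiL).
have [z hz] := @riesz _ _ phi' (ex_intro _ M pM).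
by exists z => x; rewrite /rdot -hz.
Qed.

End RealInnerProduct.

(** * Bounded operators, their norms and adjoints *)

Section Operators.
Set Implicit Arguments.
Unset Strict Implicit.
Local Open Scope classical_set_scope.
Local Open Scope ring_scope.
Local Open Scope complex_scope.
Variables (R : realType) (E F : hilbertType R).
Implicit Types (A : {bounded E -> F}).

Lemma bundle_bounded (f : E -> F) (M : R) :
  linear f -> (forall x, hnorm (f x) <= M * hnorm x) ->
  exists A : {bounded E -> F}, A =1 f.
Proof.
move=> fL fM.
pose A : {bounded E -> F} := HB.pack f (GRing.isLinear.Build _ _ _ _ f fL)
  (isBoundedOp.Build R E F f (ex_intro _ M fM)).
by exists A.
Qed.

Lemma rdot_adjoint A x y : rdot (A x) y = rdot x (adjoint A y).
Proof. by rewrite /rdot adjointP. Qed.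

(** Evaluate the inner product of [A A* y] and [y]: it is [|A* y|^2] and at most
    [M |A* y| |y|]. *)
Lemma hnorm_adjoint_le A (M : R) : 0 <= M ->
  (forall x, hnorm (A x) <= M * hnorm x) ->
  forall y, hnorm (adjoint A y) <= M * hnorm y.
Proof.
move=> M0 AM y; have := rdot_le (A (adjoint A y)) y.
rewrite rdot_adjoint rdotxx => le1.
have := hnorm_ge0 (adjoint A y); rewrite le_eqVlt => /orP[/eqP <-|a0].
  by rewrite mulr_ge0// hnorm_ge0.
rewrite -(ler_pM2l a0) -expr2 (le_trans le1)// mulrCA mulrA.
by rewrite ler_wpM2r ?hnorm_ge0.
Qed.

Lemma opnorm_has_ubound A :
  has_ubound [set hnorm (A x) | x in [set x | hnorm x <= 1]].
Proof.
have [M AM] := @boundedP _ _ _ A.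
exists `|M| => _ [x /= x1 <-]; rewrite (le_trans (AM x))//.
apply: (@le_trans _ _ (`|M| * hnorm x)).
  by rewrite ler_wpM2r ?hnorm_ge0// ler_norm.
by rewrite -[leRHS]mulr1 ler_wpM2l.
Qed.

Lemma hnorm_le_opnorm A x : hnorm (A x) <= opnorm A * hnorm x.
Proof.
have [x0|xn0] := eqVneq (hnorm x) 0.
  by rewrite (hnorm0_eq0 x0) linear0 !hnorm0 mulr0.
have xp : 0 < hnorm x by rewrite lt_neqAle eq_sym xn0 hnorm_ge0.
rewrite -ler_pdivrMr// mulrC.
have xV : complex.Re `|(hnorm x)^-1%:C| = (hnorm x)^-1.
  by rewrite normc_def/= expr0n addr0 sqrtr_sqr ger0_norm// invr_ge0 ltW.
apply: (ub_le_sup (opnorm_has_ubound A)); exists ((hnorm x)^-1%:C *: x) => /=.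
  by rewrite hnorm_scale xV mulVf.
by rewrite linearZ/= hnorm_scale xV.
Qed.

Lemma opnorm_ge0 A : 0 <= opnorm A.
Proof.
rewrite -(hnorm0 F) -(linear0 A); apply: (ub_le_sup (opnorm_has_ubound A)).
by exists 0; rewrite //= hnorm0.
Qed.

Lemma opnorm_le A M : 0 <= M -> (forall x, hnorm (A x) <= M * hnorm x) ->
  opnorm A <= M.
Proof.
move=> M0 AM; apply: ge_sup; first by exists (hnorm (A 0)), 0; rewrite //= hnorm0.
move=> _ [x /= x1 <-]; rewrite (le_trans (AM x))//.
by rewrite -[leRHS]mulr1 ler_wpM2l.
Qed.

Lemma contractive_hnorm A : contractive A -> forall x, hnorm (A x) <= hnorm x.
Proof.
move=> A1 x; rewrite (le_trans (hnorm_le_opnorm A x))//.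
by rewrite -[leRHS]mul1r ler_wpM2r ?hnorm_ge0.
Qed.

(** Expanding [|A* A x - x|^2] gives [|A* A x|^2 - |x|^2], which is at most 0 as
    [A*] is a contraction. *)
Lemma isometric_adjointK A : isometric A -> cancel A (adjoint A).
Proof.
move=> Ai x; apply/eqP; rewrite -subr_eq0; apply/eqP/hnorm0_eq0/eqP.
rewrite -sqrf_eq0 eq_le sqr_ge0 andbT.
have AA1 : hnorm (adjoint A (A x)) <= hnorm x.
  rewrite -(Ai x) -[leRHS]mul1r; apply: hnorm_adjoint_le => // z.
  by rewrite mul1r Ai.
rewrite -rdotxx rdotDl !rdotDr !rdotNl !rdotNr !rdotxx (rdotC _ x).
rewrite -rdot_adjoint rdotxx Ai.
have := hnorm_ge0 (adjoint A (A x)); nra.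
Qed.

End Operators.

Section AdjointAlgebra.
Set Implicit Arguments.
Unset Strict Implicit.
Local Open Scope classical_set_scope.
Local Open Scope ring_scope.
Local Open Scope complex_scope.

Lemma adjointK (R : realType) (E F : hilbertType R) (A : {bounded E -> F}) :
  adjoint (adjoint A) =1 A.
Proof.
by move=> x; apply: rdot_inj => y; rewrite -rdot_adjoint rdotC -rdot_adjoint rdotC.
Qed.

Lemma adjoint_comp (R : realType) (E F G : hilbertType R)
    (B : {bounded F -> G}) (A : {bounded E -> F}) :
  adjoint (B \o A) =1 adjoint A \o adjoint B.
Proof. by move=> x; apply: rdot_inj => y /=; rewrite -!rdot_adjoint. Qed.

Lemma is_lift_comp (R : realType) (H K : hilbertType R) (J : {bounded H -> K})
    (A1 A2 : {bounded H -> H}) (B1 B2 : {bounded K -> K}) :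
  is_lift J A1 B1 -> is_lift J A2 B2 -> is_lift J (A1 \o A2) (B1 \o B2).
Proof. by move=> l1 l2 x; rewrite !adjoint_comp /= l1 l2. Qed.

Lemma isometric_rdot (R : realType) (E F : hilbertType R) (A : {bounded E -> F}) :
  isometric A -> forall x y, rdot (A x) (A y) = rdot x y.
Proof. by move=> Ai x y; rewrite rdot_adjoint isometric_adjointK. Qed.

End AdjointAlgebra.

(** * Banach limits *)

Section BanachLimit.
Set Implicit Arguments.
Unset Strict Implicit.
Local Open Scope classical_set_scope.
Local Open Scope ring_scope.

(** Of a set and its complement, one has its preimage in [U]. *)
Lemma ultra_pushforward (S T : Type) (f : S -> T) (U : set_system S) :
  UltraFilter U -> UltraFilter (f @ U).
Proof.
move=> UU; split=> [|G GG sG]; first exact: fmap_proper_filter.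
rewrite predeqE => A; split=> [GA|]; last exact: sG.
have [//|UnA] := in_ultra_setVsetC (f @^-1` A) UU.
have GnA : G (~` A) by exact: sG.
by have /filter_ex[x []] : G (A `&` ~` A) by exact: filterI.
Qed.

(** [L u] is the limit of the Cesaro means of [u] along a free ultrafilter.  It
    exists by compactness of segments, and it is shift invariant because the
    means of [u] and of its shift differ by [(u n.+1 - u 0) / n.+1]. *)
Lemma banach_limit (R : realType) : exists L : (nat -> R) -> R,
  let bnd (u : nat -> R) := exists M, forall n, `|u n| <= M in
  [/\ forall u v, bnd u -> bnd v -> L (u \+ v) = L u + L v,
      forall t u, bnd u -> L (t \*o u) = t * L u,
      forall u M, bnd u -> (forall n, u n <= M) -> L u <= M
    & forall u, bnd u -> L (fun n => u n.+1) = L u].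
Proof.
have [U [UU sU]] := @ultraFilterLemma nat \oo _.
pose c (u : nat -> R) n := n.+1%:R^-1 * \sum_(k < n.+1) u k.
pose bnd (u : nat -> R) := exists M, forall n, `|u n| <= M.
have n0 n : (0 : R) < n.+1%:R^-1 by rewrite invr_gt0 ltr0Sn.
have sumM (M : R) n : n.+1%:R^-1 * \sum_(k < n.+1) M = M.
  by rewrite sumr_const card_ord -[M *+ _]mulr_natl mulrA mulVf ?mul1r// pnatr_eq0.
have cle u M : (forall n, u n <= M) -> forall n, c u n <= M.
  move=> uM n; rewrite -(sumM M n) ler_pM2l//.
  by apply: ler_sum => k _.
have cN u n : c (\- u) n = - c u n by rewrite /c sumrN mulrN.
have cbnd u : bnd u -> bnd (c u).
  move=> [M uM]; exists M => n; rewrite ler_norml.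
  rewrite (cle u) ?andbT => [|k]; last exact: le_trans (ler_norm _) (uM k).
  rewrite lerNl -cN; apply: cle => k /=.
  by rewrite (le_trans (ler_norm _))// normrN.
have cv u : bnd u -> exists l : R, c u @ U --> l.
  move=> /cbnd[M cM].
  have := @segment_compact R (- M) M; rewrite compact_ultra.
  have UI : UltraFilter (c u @ U) by exact: ultra_pushforward.
  move=> /(_ (c u @ U) UI)[|l [_ cl]]; last by exists l.
  by apply: (@filterE _ U) => n /=; rewrite in_itv/= -ler_norml.
pose L u : R := lim (c u @ U).
have Lcv u : bnd u -> c u @ U --> L u by move=> /cv[l cl]; apply/cvg_ex; exists l.
have LE u l : c u @ U --> l -> L u = l by move=> cl; apply: cvg_lim.
exists L => /=; split.
- move=> u v bu bv; apply: LE.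
  have -> : c (u \+ v) = c u \+ c v.
    by apply/funext => n; rewrite /c /= big_split/= mulrDr.
  by apply: cvgD; apply: Lcv.
- move=> t u bu; apply: LE.
  have -> : c (t \*o u) = (fun n => t * c u n).
    by apply/funext => n; rewrite /c /= -mulr_sumr mulrCA.
  by apply: cvgMl_tmp; apply: Lcv.
- move=> u M bu uM; apply: limr_le; first by have [l cl] := cv u bu; apply/cvg_ex; exists l.
  by apply: filterE => n; apply: cle.
- move=> u bu; apply: LE.
  have -> : c (fun n => u n.+1) = (fun n => c u n + n.+1%:R^-1 * (u n.+1 - u 0%N)).
    apply/funext => n; rewrite /c -mulrDr; congr (_ * _).
    have e : \sum_(k < n.+2) u k = u 0%N + \sum_(k < n.+1) u k.+1.
      exact: big_ord_recl.
    by move: e; rewrite big_ord_recr/=; lra.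
  rewrite -[L u]addr0; apply: cvgD; first exact: Lcv.
  case: bu => M uM.
  apply: cvg_trans (_ : (fun n => n.+1%:R^-1 * (u n.+1 - u 0%N)) @ \oo --> (0:R)).
    by move=> A; apply: sU.
  have h0 m : (fun n => m * n.+1%:R^-1) @ \oo --> (0 : R).
    by rewrite -(mulr0 m); apply: cvgMl_tmp; apply: cvg_harmonic.
  apply: (squeeze_cvgr _ (h0 (- (M + M))) (h0 (M + M))).
  apply: filterE => n /=; rewrite mulNr -ler_norml normrM [leRHS]mulrC.
  by rewrite (ger0_norm (ltW (n0 n))) ler_pM2l// (le_trans (ler_normB _ _))// lerD.
Qed.
End BanachLimit.

Section WeakLimit.
Set Implicit Arguments.
Unset Strict Implicit.
Local Open Scope classical_set_scope.
Local Open Scope ring_scope.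
Local Open Scope complex_scope.
Variables (R : realType) (E F : hilbertType R).

(** [Z x] represents the functional sending [y] to the Banach limit of the inner
    products of [y] with [Zn n x].  The last clause turns a recursion that links
    [Zn n.+1] to [Zn n] into an identity for [Z], by shift invariance. *)
Lemma weak_banach_limit (Zn : nat -> {bounded E -> F}) (M : R) : 0 <= M ->
  (forall n x, hnorm (Zn n x) <= M * hnorm x) ->
  exists Z : {bounded E -> F},
    [/\ forall x, hnorm (Z x) <= M * hnorm x,
        forall x z, (forall n, Zn n x = z) -> Z x = z
      & forall x x' y y', (forall n, rdot y (Zn n.+1 x) = rdot y' (Zn n x')) ->
          rdot y (Z x) = rdot y' (Z x')].
Proof.
move=> M0 ZM; have [L [LD LZ Lle Lshift]] := banach_limit R.
pose u x y n := rdot y (Zn n x).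
have ub x y n : u x y n <= M * hnorm x * hnorm y.
  by rewrite /u (le_trans (rdot_le _ _))// mulrC ler_wpM2r ?hnorm_ge0.
have bu x y : exists N, forall n, `|u x y n| <= N.
  exists (M * hnorm x * hnorm y) => n; rewrite ler_norml ub andbT.
  by rewrite lerNl -(hnorm_opp y) (le_trans _ (ub x (- y) n))// /u rdotNl.
have uDr x y y' : u x (y + y') = u x y \+ u x y'.
  by apply/funext => n; rewrite /u rdotDl.
have uZ x y t : u x (t%:C *: y) = t \*o u x y.
  by apply/funext => n; rewrite /u rdotZl.
have ex x : {z | forall y, L (u x y) = rdot y z}.
  apply/cid/(real_riesz (M := M * hnorm x)) => [y y'|t y|y].
  - by rewrite uDr LD.
  - by rewrite uZ LZ.
  - by apply: Lle => // n; apply: ub.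
pose f x := projT1 (ex x).
have fE x y : rdot y (f x) = L (u x y) by rewrite /f; case: (ex x).
have fM x : hnorm (f x) <= M * hnorm x.
  have : hnorm (f x) ^+ 2 <= M * hnorm x * hnorm (f x).
    by rewrite -rdotxx fE; apply: Lle => // n; apply: ub.
  have := hnorm_ge0 (f x); rewrite le_eqVlt => /orP[/eqP <- _|f0].
    by rewrite mulr_ge0// hnorm_ge0.
  by rewrite expr2 ler_pM2r.
have fL : linear f.
  move=> a x x'; apply: rdot_inj => y.
  rewrite rdotDr rdotZr_conj !fE -LD//; congr L.
  by apply/funext => n; rewrite /u /= linearP rdotDr rdotZr_conj.
have [Z Zf] := bundle_bounded fL fM.
exists Z; split=> [x|x z h|x x' y y' h]; rewrite !Zf//.
  apply: rdot_inj => y; rewrite fE; apply/eqP; rewrite eq_le.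
  have uE n : u x y n = rdot y z by rewrite /u h.
  rewrite Lle// => [|n]; last by rewrite uE.
  rewrite -lerN2 -(mulN1r (L _)) -LZ// Lle// => [|n]; last by rewrite /= uE mulN1r.
  by have [N uN] := bu x y; exists N => n; rewrite /= mulN1r normrN.
by rewrite !fE -Lshift//; congr L; apply/funext => n; apply: h.
Qed.

End WeakLimit.

(** * Extension of operators dominated by a quadratic form *)

Section DominatedExtension.
Set Implicit Arguments.
Unset Strict Implicit.
Local Open Scope classical_set_scope.
Local Open Scope ring_scope.
Local Open Scope complex_scope.

(** The extension is [D0] applied to the orthogonal projection onto the range of
    [J] for the form [b].  This form may be degenerate and its quotient
    incomplete, so the projection itself need not exist; but [D0] sends
    minimizing sequences for the distance of [x] to the range of [J] to Cauchy
    sequences of the complete space [F], and [D x] is their limit.  With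
    [s x = b x x] and [d x] the squared distance, the parallelogram law drives
    both the Cauchy estimate and additivity.  Complex linearity comes from the
    hypothesis on [b (a *: x) (a *: x)], by which scaling by [a] maps almost
    minimizers to almost minimizers. *)
Lemma dominated_extension (R : realType) (H E : lmodType R[i]) (F : hilbertType R)
    (J : {linear H -> E}) (D0 : {linear H -> F}) (b : E -> E -> R) :
  (forall x y, b x y = b y x) ->
  (forall x y z, b (x + y) z = b x z + b y z) ->
  (forall t x y, b (t%:C *: x) y = t * b x y) ->
  (forall a x, b (a *: x) (a *: x) = complex.Re `|a| ^+ 2 * b x x) ->
  (forall x, 0 <= b x x) ->
  (forall h, hnorm (D0 h) ^+ 2 <= b (J h) (J h)) ->
  exists D : E -> F,
    [/\ linear D, forall h, D (J h) = D0 h & forall x, hnorm (D x) ^+ 2 <= b x x].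
Proof.
move=> bC bDl bZl bZZ b0 D0b.
have bDr x y z : b z (x + y) = b z x + b z y by rewrite bC bDl !(bC z).
have bZr t x y : b y (t%:C *: x) = t * b y x by rewrite bC bZl bC.
have m1 : -1 = (-1)%:C :> R[i] by rewrite raddfN.
have bNl x y : b (- x) y = - b x y by rewrite -scaleN1r m1 bZl mulN1r.
have bNr x y : b y (- x) = - b y x by rewrite bC bNl bC.
pose bE := (bDl, bDr, bNl, bNr, bZl, bZr).
pose s x := b x x.
pose V x := [set s (x - J h) | h in [set: H]].
pose d x := inf (V x).
have infV x : has_inf (V x).
  by split; [exists (s (x - J 0)), 0 | exists 0 => _ [h _ <-]; exact: b0].
have d_le x h : d x <= s (x - J h).
  by apply: ge_inf; [case: (infV x) | exists h].
have d_ge0 x : 0 <= d x.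
  by apply: lb_le_inf; [case: (infV x) | move=> _ [h _ <-]; exact: b0].
pose near x e h := s (x - J h) <= d x + e ^+ 2.
have near_ex x e : 0 < e -> exists h, near x e h.
  move=> e0; have /inf_adherent -/(_ _ (infV x))[_ [h _ <-] /ltW] : 0 < e ^+ 2.
    by rewrite exprn_gt0.
  by exists h.
have near_le x e e' h : 0 <= e -> e <= e' -> near x e h -> near x e' h.
  move=> e0 ee' /le_trans; apply; rewrite lerD2l.
  by rewrite lerXn2r// nnegrE (le_trans e0).
(* The midpoint of two almost minimizers is again a candidate, so the
   parallelogram law bounds the form on their difference. *)
have near_close x e h h' : 0 <= e -> near x e h -> near x e h' ->
    hnorm (D0 h - D0 h') <= 2 * e.
  move=> e0 nh nh'; rewrite -linearB -(@ler_pXn2r _ 2)// ?nnegrE ?mulr_ge0 ?hnorm_ge0//.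
  rewrite (le_trans (D0b _))// linearB.
  have := d_le x ((2^-1)%:C *: (h + h')); move: nh nh'.
  rewrite /near linearZ/= linearD /s !bE (bC (J h') (J h)) !(bC (J _) x).
  lra.
(* This inequality (an equality, in fact) makes sums of almost minimizers almost
   minimizing, which is what additivity of [D] rests on. *)
have d_parallelogram x y : 2 * d x + 2 * d y <= d (x + y) + d (x - y).
  apply/ler_addgt0Pl => e e0.
  pose r := Num.sqrt (e / 2).
  have r0 : 0 < r by rewrite sqrtr_gt0 divr_gt0.
  have rE : r ^+ 2 = e / 2 by rewrite sqr_sqrtr// ltW// divr_gt0.
  have [h nh] := near_ex (x + y) r r0; have [k nk] := near_ex (x - y) r r0.
  have := d_le x ((2^-1)%:C *: (h + k)); have := d_le y ((2^-1)%:C *: (h - k)).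
  move: nh nk; rewrite /near rE !linearZ/= !linearD !linearN /s !bE.
  rewrite (bC (J k) (J h)) !(bC (J _) x) !(bC (J _) y) (bC y x).
  lra.
have nearD x y e h h' : near x e h -> near y e h' -> near (x + y) (2 * e) (h + h').
  move=> nh nh'; have := d_parallelogram x y; have := d_le (x - y) (h - h').
  move: nh nh'; rewrite /near !linearD !linearN exprMn /s !bE.
  rewrite (bC (J h') (J h)) !(bC (J _) x) !(bC (J _) y) (bC y x).
  lra.
have sZ a x : s (a *: x) = complex.Re `|a| ^+ 2 * s x by exact: bZZ.
have dZ a x : complex.Re `|a| ^+ 2 * d x <= d (a *: x).
  apply: lb_le_inf; first by case: (infV (a *: x)).
  move=> _ [h _ <-]; have [->|a0] := eqVneq a 0.
    by rewrite normr0 expr0n mul0r; exact: b0.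
  have -> : a *: x - J h = a *: (x - J (a^-1 *: h)).
    by rewrite scalerBr [J (_ *: _)]linearZ/= scalerA mulfV// scale1r.
  by rewrite sZ ler_wpM2l ?sqr_ge0.
have nearZ a x e h : near x e h -> near (a *: x) (complex.Re `|a| * e) (a *: h).
  rewrite /near linearZ/= -scalerBr sZ exprMn => nh.
  by rewrite (le_trans (ler_wpM2l (sqr_ge0 _) nh))// mulrDr lerD2r.
(* The images under [D0] of the sets of almost minimizers form a Cauchy filter. *)
have ex x : {l : F | forall e h, 0 <= e -> near x e h -> hnorm (l - D0 h) <= 2 * e}.
  apply/cid.
  pose G : set_system F := filter_from [set e : R | 0 < e] (fun e => D0 @` near x e).
  have GF : ProperFilter G.
    apply: filter_from_proper; last first.
      by move=> e /= /(near_ex x)[h nh]; exists (D0 h), h.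
    apply: filter_from_filter; first by exists 1 => /=.
    move=> e f /= e0 f0; have m0 : 0 < Num.min e f by rewrite lt_min e0.
    exists (Num.min e f) => // _ [h nh <-].
    by split; exists h => //; apply: near_le nh; rewrite ?(ltW m0)// ge_min lexx ?orbT.
  have Gc : cauchy G.
    apply/cauchy_ballP => e e0.
    have [eC r0] : e = (complex.Re e)%:C /\ 0 < complex.Re e.
      have eC : e = (complex.Re e)%:C by rewrite RRe_real// gtr0_real.
      by split; rewrite // -ltcR -eC.
    set r := complex.Re e in eC r0.
    pose A := D0 @` near x (r / 4).
    have GA : G A by exists (r / 4) => //=; rewrite divr_gt0.
    exists (A, A) => //= -[_ _] /= [[h nh <-] [k nk <-]].
    rewrite -ball_normE/= eC hnormC ltcR (le_lt_trans (near_close x _ _ _ _ nh nk))//; lra.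
  have /cvg_ex[l Gl] : cvg G by exact: cauchy_cvg.
  exists l => e h e0 nh; apply/ler_addgt0Pr => c c0.
  have : G (ball l (c / 3)%:C `&` (D0 @` near x (e + c / 3))).
    apply: filterI; first by apply: Gl; apply: nbhsx_ballx; rewrite ltcR divr_gt0.
    by exists (e + c / 3) => //=; lra.
  move=> /filter_ex[y [lk [k nk yk]]]; rewrite -{y}yk in lk.
  have {}lk : hnorm (l - D0 k) < c / 3 by move: lk; rewrite -ball_normE/= hnormC ltcR.
  have {}nh : near x (e + c / 3) h by apply: near_le nh => //; lra.
  have ec0 : 0 <= e + c / 3 by lra.
  have := near_close _ _ _ _ ec0 nk nh.
  have := hnorm_add (l - D0 k) (D0 k - D0 h); rewrite addrA subrK.
  lra.
pose D x := projT1 (ex x).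
have Dnear x e h : 0 <= e -> near x e h -> hnorm (D x - D0 h) <= 2 * e.
  by rewrite /D; case: (ex x) => l /= hl; exact: hl.
have small (u v : F) C : (forall e, 0 < e -> hnorm (u - v) <= C * e) -> u = v.
  move=> uv; apply/eqP; rewrite -subr_eq0; apply/eqP/hnorm0_eq0/eqP.
  rewrite eq_le hnorm_ge0 andbT; apply/ler_addgt0Pl => e e0; rewrite addr0.
  have C1 : 0 < `|C| + 1 by have := normr_ge0 C; lra.
  have := uv (e / (`|C| + 1)); rewrite divr_gt0// => /(_ isT) /le_trans; apply.
  rewrite mulrA ler_pdivrMr// mulrC ler_pM2l//.
  by have := ler_norm C; lra.
have DD x y : D (x + y) = D x + D y.
  apply: (small _ _ 8) => e e0.
  have [h nh] := near_ex x e e0; have [k nk] := near_ex y e e0.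
  have nhk := nearD _ _ _ _ _ nh nk.
  have h1 := Dnear _ _ _ (ltW e0) nh; have h2 := Dnear _ _ _ (ltW e0) nk.
  have h3 : hnorm (D (x + y) - D0 (h + k)) <= 2 * (2 * e).
    by apply: Dnear nhk; lra.
  have -> : D (x + y) - (D x + D y) =
      (D (x + y) - D0 (h + k)) + (- (D x - D0 h) + - (D y - D0 k)).
    by rewrite linearD !opprB [D0 h - D x + _]addrACA -opprD addrA subrK.
  have := hnorm_add (D (x + y) - D0 (h + k)) (- (D x - D0 h) + - (D y - D0 k)).
  have := hnorm_add (- (D x - D0 h)) (- (D y - D0 k)); rewrite !hnorm_opp.
  lra.
have DZ a x : D (a *: x) = a *: D x.
  apply: (small _ _ (4 * complex.Re `|a|)) => e e0.
  have [h nh] := near_ex x e e0.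
  have h1 := Dnear _ _ _ (ltW e0) nh.
  have a0 : 0 <= complex.Re `|a| by rewrite -ler0c RRe_real ?normr_real.
  have h2 : hnorm (D (a *: x) - D0 (a *: h)) <= 2 * (complex.Re `|a| * e).
    by apply: Dnear (nearZ _ _ _ _ nh); rewrite mulr_ge0// ltW.
  have -> : D (a *: x) - a *: D x =
      (D (a *: x) - D0 (a *: h)) - a *: (D x - D0 h).
    by rewrite scalerBr [D0 (_ *: _)]linearZ/= opprB addrA subrK.
  rewrite (le_trans (hnorm_add _ _))// hnorm_opp hnorm_scale.
  by have := ler_wpM2l a0 h1; lra.
exists D; split=> [a x y|h|x].
- by rewrite DD DZ.
- apply: (small _ _ 0) => e e0; rewrite mul0r -(mulr0 2); apply: Dnear => //.
  by rewrite /near subrr expr0n addr0 -(scale0r 0) sZ normr0 expr0n mul0r d_ge0.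
- suff le1 : hnorm (D x) <= Num.sqrt (s x).
    by rewrite -(sqr_sqrtr (b0 x)) ler_pXn2r// ?nnegrE ?sqrtr_ge0// hnorm_ge0.
  apply/ler_addgt0Pl => c c0; pose e := c / 4.
  have e0 : 0 < e by rewrite divr_gt0.
  have [h nh] := near_ex x e e0.
  pose n := Num.sqrt (s (J h)); pose q := Num.sqrt (s x).
  have n0 : 0 <= n by rewrite sqrtr_ge0.
  have q0 : 0 <= q by rewrite sqrtr_ge0.
  have nE : n ^+ 2 = s (J h) by rewrite sqr_sqrtr// b0.
  have qE : q ^+ 2 = s x by rewrite sqr_sqrtr// b0.
  have D0n : hnorm (D0 h) <= n.
    by rewrite -(@ler_pXn2r _ 2)// ?nnegrE ?hnorm_ge0// nE.
  (* An approximate Pythagoras: for an exact projection [h] of [x] the form is no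
     larger on [J h] than on [x].  Comparing [h] with [(1 - e / n) *: h] shows
     that [x - J h] is orthogonal to [J h] up to [e n]. *)
  have nq : n <= 2 * e + q.
    have [n00|nn0] := eqVneq n 0; first by rewrite n00; lra.
    have np : 0 < n by rewrite lt_neqAle eq_sym nn0.
    have := d_le x ((1 - e / n)%:C *: h); move: (nh).
    rewrite /near linearZ /s !bE (bC (J h) x) -/(s (J h)) -/(s x) -nE -qE => h1 h2.
    have h3 : 0 <= e ^+ 2 + 2 * (e / n) * (b x (J h) - n ^+ 2) + (e / n) ^+ 2 * n ^+ 2.
      lra.
    have h4 : (e / n) ^+ 2 * n ^+ 2 = e ^+ 2 by field.
    have h5 : (e / n) * n ^+ 2 = e * n by field.
    have h6 : n ^+ 2 - e * n <= b x (J h).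
      rewrite -(ler_pM2l (_ : 0 < e / n)) ?divr_gt0// mulrBr h5.
      have -> : e / n * (e * n) = e ^+ 2 by field.
      lra.
    have := b0 (x - J h); rewrite !bE (bC (J h) x) -/(s (J h)) -/(s x) -nE -qE => h7.
    have [//|h8] := lerP n (2 * e + q).
    have h9 : 0 < n * (n - (2 * e + q)) by rewrite mulr_gt0// subr_gt0.
    have h10 : 0 <= q * (n - q) by rewrite mulr_ge0//; lra.
    suff : (1 : R) <= 0 by rewrite ler10.
    lra.
  have := Dnear _ _ _ (ltW e0) nh.
  have := hnorm_add (D x - D0 h) (D0 h); rewrite subrK /e; rewrite /e in nq; rewrite -/q.
  lra.
Qed.
End DominatedExtension.

(** * Commutant lifting *)

Section CommutantLifting.
Set Implicit Arguments.
Unset Strict Implicit.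
Local Open Scope classical_set_scope.
Local Open Scope ring_scope.
Local Open Scope complex_scope.

(** The range of [V] is orthogonal to the kernel of [V*], and [1 - V V*] is the
    projection onto the latter. *)
Lemma hnorm_isometry_split (R : realType) (K : hilbertType R)
    (V : {bounded K -> K}) x y :
  isometric V ->
  hnorm (V x + (y - V (adjoint V y))) ^+ 2 =
  hnorm x ^+ 2 + (hnorm y ^+ 2 - hnorm (adjoint V y) ^+ 2).
Proof.
move=> Vi; rewrite -!rdotxx !rdotDl !rdotDr !rdotNl !rdotNr !(isometric_rdot Vi).
by rewrite !(rdotC y (V _)) !(rdot_adjoint V) (rdotC (adjoint V y) x); ring.
Qed.

(** The situation on the side of adjoints: [C] leaves the range of [J] invariant
    and acts there as [A], and [Z0], defined on this range, intertwines [A] with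
    the coisometry [V*]. *)
Section Step.
Variables (R : realType) (M K L : hilbertType R).
Variables (V : {bounded L -> L}) (C : {bounded K -> K}) (A : {bounded M -> M}).
Variables (J : {bounded M -> K}) (Z0 : {bounded M -> L}) (g : R).
Hypotheses (Vi : isometric V) (C1 : forall x, hnorm (C x) <= hnorm x).
Hypotheses (Ji : isometric J) (g0 : 0 <= g).
Hypothesis CJ : forall h, C (J h) = J (A h).
Hypothesis VZ0 : forall h, adjoint V (Z0 h) = Z0 (A h).
Hypothesis Z0g : forall h, hnorm (Z0 h) <= g * hnorm h.

Let admissible (Z : {bounded K -> L}) :=
  (forall x, hnorm (Z x) <= g * hnorm x) /\ (forall h, Z (J h) = Z0 h).

(** The equation forces [Z' = V Z C + D] with [V* D = 0].  By orthogonality the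
    norm bound for [Z'] says that [D] is dominated by the form [b] below, and the
    extension condition prescribes [D] on the range of [J] as [Z0 - V V* Z0]. *)
Lemma intertwining_step Z : admissible Z ->
  exists Z', admissible Z' /\ forall x, adjoint V (Z' x) = Z (C x).
Proof.
move=> [Zg ZJ].
pose b x y := g ^+ 2 * rdot x y - rdot (Z (C x)) (Z (C y)).
pose D0 : {linear M -> L} := Z0 \- (V \o (adjoint V \o Z0)).
have bxx x : b x x = g ^+ 2 * hnorm x ^+ 2 - hnorm (Z (C x)) ^+ 2.
  by rewrite /b !rdotxx.
have ZC x : hnorm (Z (C x)) <= g * hnorm x.
  by rewrite (le_trans (Zg _))// ler_wpM2l.
have D0E h : hnorm (D0 h) ^+ 2 = hnorm (Z0 h) ^+ 2 - hnorm (adjoint V (Z0 h)) ^+ 2.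
  by have := hnorm_isometry_split 0 (Z0 h) Vi; rewrite linear0 add0r hnorm0 expr0n add0r.
have [||||||D [DL DJ Db]] := @dominated_extension R M K L J D0 b.
- by move=> x y; rewrite /b rdotC (rdotC (Z _)).
- by move=> x y z; rewrite /b !linearD !rdotDl; ring.
- by move=> t x y; rewrite /b [C (_ *: _)]linearZ/= [Z (_ *: _)]linearZ/= !rdotZl; ring.
- move=> a x; set n := complex.Re _.
  by rewrite /b [C (_ *: _)]linearZ/= [Z (_ *: _)]linearZ/= !rdotZZ -/n; ring.
- move=> x; rewrite bxx subr_ge0 -exprMn ler_pXn2r// nnegrE ?hnorm_ge0//.
  by rewrite mulr_ge0 ?hnorm_ge0.
- move=> h; rewrite D0E bxx Ji CJ ZJ VZ0 lerD2r -exprMn.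
  by rewrite ler_pXn2r// nnegrE ?mulr_ge0 ?hnorm_ge0.
pose D' : {linear K -> L} := HB.pack D (GRing.isLinear.Build _ _ _ _ D DL).
(* The extension [D] may leave the kernel of [V*]; projecting it back changes
   neither its values on the range of [J] nor the bound. *)
pose f : {linear K -> L} := (V \o (Z \o C)) \+ (D' \- (V \o (adjoint V \o D'))).
have fE x : f x = V (Z (C x)) + (D x - V (adjoint V (D x))) by [].
have fg x : hnorm (f x) <= g * hnorm x.
  rewrite -(@ler_pXn2r _ 2)// ?nnegrE ?mulr_ge0 ?hnorm_ge0//.
  rewrite fE hnorm_isometry_split// exprMn.
  have := Db x; rewrite bxx; have := sqr_ge0 (hnorm (adjoint V (D x))); lra.
have [Z' Z'f] := bundle_bounded (linearP f) fg.
exists Z'; split; [split=> [x|h]|move=> x]; rewrite Z'f//.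
  rewrite fE CJ ZJ DJ /D0/= linearB/= isometric_adjointK// subrr linear0 subr0.
  by rewrite VZ0 addrC subrK.
by rewrite fE linearD linearB/= !isometric_adjointK// subrr addr0.
Qed.

(** Iterate the step from [Z0 J*] and take a Banach limit: the recursion
    [V* Z_(n+1) = Z_n C] becomes [V* Z = Z C]. *)
Lemma intertwining_extension :
  exists Z : {bounded K -> L},
    [/\ forall x, hnorm (Z x) <= g * hnorm x, forall h, Z (J h) = Z0 h
      & forall x, adjoint V (Z x) = Z (C x)].
Proof.
have base : admissible (Z0 \o adjoint J).
  split=> [x|h] /=; last by rewrite isometric_adjointK.
  rewrite (le_trans (Z0g _))// ler_wpM2l// -[leRHS]mul1r.
  by apply: hnorm_adjoint_le => // h; rewrite mul1r Ji.
have step (Z : {Z | admissible Z}) :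
    {Z' : {Z' | admissible Z'} | forall x, adjoint V (projT1 Z' x) = projT1 Z (C x)}.
  case: Z => Z aZ; have /cid[Z' [aZ' h]] := intertwining_step aZ.
  by exists (exist _ Z' aZ').
pose Zn n := iter n (fun Z => projT1 (step Z)) (exist _ _ base).
have [|Z [Zg Zcst Zshift]] := @weak_banach_limit R K L (fun n => projT1 (Zn n)) g g0.
  by move=> n; case: (Zn n) => Y [].
exists Z; split=> // [h|x].
  by apply: Zcst => n; case: (Zn n) => Y [].
apply: rdot_inj => y; rewrite -rdot_adjoint; apply: Zshift => n.
by rewrite rdot_adjoint /=; case: (step (Zn n)) => Z' /= ->.
Qed.
End Step.

(** The adjoint of [Y] is an intertwining extension of [J1 X*] from the range of
    [J2].  Lifting never decreases the norm, since [X = J2* Y J1]. *)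
Theorem commutant_lifting (R : realType) (H1 H2 K1 K2 : hilbertType R)
    (T1 : {bounded H1 -> H1}) (T2 : {bounded H2 -> H2}) (X : {bounded H1 -> H2})
    (J1 : {bounded H1 -> K1}) (J2 : {bounded H2 -> K2})
    (V : {bounded K1 -> K1}) (W : {bounded K2 -> K2}) :
  isometric J1 -> isometric J2 -> is_isometric_lift J1 T1 V ->
  is_lift J2 T2 W -> contractive W -> X \o T1 =1 T2 \o X ->
  exists Y : {bounded K1 -> K2},
    [/\ forall x, adjoint Y (J2 x) = J1 (adjoint X x), opnorm Y = opnorm X
      & Y \o V =1 W \o Y].
Proof.
move=> J1i J2i [lV Vi] lW /contractive_hnorm W1 XT.
have W1' x : hnorm (adjoint W x) <= hnorm x.
  rewrite -[leRHS]mul1r; apply: hnorm_adjoint_le => // z.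
  by rewrite mul1r.
have X0 := opnorm_ge0 X.
have [|h|Z [Zg ZJ VZ]] := @intertwining_extension R H2 K2 K1 V (adjoint W)
    (adjoint T2) J2 (J1 \o adjoint X) (opnorm X) Vi W1' J2i X0 lW.
- move=> h /=; rewrite lV; congr (J1 _); apply: rdot_inj => x.
  by rewrite -!rdot_adjoint; congr (rdot _ _); apply: XT.
- by rewrite /= J1i; apply: hnorm_adjoint_le => // x; apply: hnorm_le_opnorm.
exists (adjoint Z); split=> [x||x].
- by rewrite adjointK ZJ.
- apply/eqP; rewrite eq_le; apply/andP; split.
    by apply: opnorm_le => // y; apply: hnorm_adjoint_le.
  have XE x : X x = adjoint J2 (adjoint Z (J1 x)).
    apply: rdot_inj => u; rewrite -!rdot_adjoint ZJ /= isometric_rdot// rdotC.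
    by rewrite rdot_adjoint rdotC.
  apply: opnorm_le => [|x]; first exact: opnorm_ge0.
  rewrite XE; apply: (@le_trans _ _ (hnorm (adjoint Z (J1 x)))).
    rewrite -[leRHS]mul1r; apply: hnorm_adjoint_le => // z.
    by rewrite mul1r J2i.
  by rewrite -(J1i x); apply: hnorm_le_opnorm.
- apply: rdot_inj => u /=; rewrite -rdot_adjoint rdotC rdot_adjoint VZ.
  by rewrite [RHS]rdotC rdot_adjoint [RHS]rdotC -rdot_adjoint rdotC.
Qed.
End CommutantLifting.

Theorem theorem1p2 (R : realType) (H K : hilbertType R)
    (T Q X : {bounded H -> H})
    (J : {bounded H -> K}) (V Qbar : {bounded K -> K}) :
  contractive T ->
  isometric J ->
  is_isometric_lift J T V ->
  is_lift J Q Qbar ->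
  [/\ X \o T =1 Q \o T \o X ->
      contractive (Q \o T) -> contractive (Qbar \o V) ->
      exists Y : {bounded K -> K},
        is_norm_preserving_lift J X Y /\ Y \o V =1 Qbar \o V \o Y,
      X \o T =1 T \o Q \o X ->
      contractive (T \o Q) -> contractive (V \o Qbar) ->
      exists Y : {bounded K -> K},
        is_norm_preserving_lift J X Y /\ Y \o V =1 V \o Qbar \o Y
    & T \o X =1 X \o T \o Q ->
      contractive Q -> isometric Qbar ->
      exists Y : {bounded K -> K},
        is_norm_preserving_lift J X Y /\ V \o Y =1 Y \o V \o Qbar].
Proof.
move=> _ Ji lV lQ; have [lV0 Vi] := lV; split.
- move=> XT _ QV1.
  have [Y [YJ YX YV]] := commutant_lifting Ji Ji lV (is_lift_comp lQ lV0) QV1 XT.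
  by exists Y.
- move=> XT _ VQ1.
  have [Y [YJ YX YV]] := commutant_lifting Ji Ji lV (is_lift_comp lV0 lQ) VQ1 XT.
  by exists Y.
- move=> TX _ Qi.
  have VQ : is_isometric_lift J (T \o Q) (V \o Qbar).
    by split=> [|x]; [exact: is_lift_comp | rewrite /= Vi Qi].
  have V1 : contractive V.
    by apply: opnorm_le => // x; rewrite mul1r Vi.
  have XTQ : X \o (T \o Q) =1 T \o X by move=> x; rewrite TX.
  have [Y [YJ YX YV]] := commutant_lifting Ji Ji VQ lV0 V1 XTQ.
  by exists Y; split=> // x; rewrite -YV.
Qed.
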